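(* Let $\mathcal{A}$ be an arbitrary C*-algebra, let $X$ be a Hilbert $\mathcal{A}$-module, and suppose $t \in \mathcal{R}(X)$ (a regular, possibly unbounded, operator on $X$) admits the polar decomposition $t = \mathcal{V}|t|$. Then $t$ is a normal operator if and only if there exists a unitary operator $\mathcal{U} \in \mathcal{L}(X)$ such that $t = \mathcal{U} t^*$. In this situation, $t\,\mathcal{U} = \mathcal{U}\,t$ and $t^*\,\mathcal{U} = \mathcal{U}\,t^*$ on $Dom(t) = Dom(t^* )$.
   Context: A (right) Hilbert $\mathcal{A}$-module is a right $\mathcal{A}$-module $X$ with an $\mathcal{A}$-valued inner product $\langle\cdot,\cdot\rangle$, $\mathcal{A}$-linear in the second variable, with $\langle x,y\rangle=\langle y,x\rangle^*$ and $\langle x,x\rangle\ge 0$ with equality only when $x=0$, that is complete for the norm $\|x\|=\|\langle x,x\rangle\|^{1/2}$. $\mathcal{L}(X)$ is the C*-algebra of all (bounded) adjointable operators on $X$. $\mathcal{U}\in\mathcal{L}(X)$ is unitary if $\mathcal{U}^*\mathcal{U}=\mathcal{U}\mathcal{U}^*=1$; $\mathcal{V}\in\mathcal{L}(X)$ is a partial isometry if $\mathcal{V}\mathcal{V}^*\mathcal{V}=\mathcal{V}$. $Dom$, $Ker$, $Ran$ denote domain, kernel and range. For a densely defined $\mathcal{A}$-linear map $t:Dom(t)\subseteq X\to X$, the adjoint $t^*$ has domain $Dom(t^* )=\{y\in X: \exists z\in X,\ \langle tx,y\rangle=\langle x,z\rangle\ \forall x\in Dom(t)\}$ and $t^*y=z$.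 A densely defined closed $\mathcal{A}$-linear map $t:Dom(t)\subseteq X\to X$ is regular if its adjoint $t^*$ is densely defined and $1+t^*t$ has dense range; $\mathcal{R}(X)$ is the set of regular operators on $X$. If $t$ is regular then so are $t^*$ and $t^*t$, and $t^*t$ is positive and selfadjoint; $|t|=(t^*t)^{1/2}$ is its positive square root. A regular $t$ is normal if $Dom(t)=Dom(t^* )$ and $\langle tx,tx\rangle=\langle t^*x,t^*x\rangle$ for all $x\in Dom(t)$. ''$t$ admits the polar decomposition $t=\mathcal{V}|t|$'' means that $\mathcal{V}\in\mathcal{L}(X)$ is a partial isometry with $t=\mathcal{V}|t|$, $Ker(\mathcal{V})=Ker(t)$, $Ker(\mathcal{V}^* )=Ker(t^* )$, $Ran(\mathcal{V})=\overline{Ran(t)}$ and $Ran(\mathcal{V}^* )=\overline{Ran(t^* )}$. Such a $\mathcal{V}$ exists (and is then unique) if and only if $X=Ker(|t|)\oplus\overline{Ran(|t|)}$ and $X=Ker(t^* )\oplus\overline{Ran(t)}$. The equality $t=\mathcal{U}t^*$ is an equality of unbounded operators, including equality of domains. *)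

(* Defs.v *)
From HB Require Import structures.
From mathcomp Require Import all_boot all_order all_algebra.
From mathcomp Require Import all_classical all_reals all_analysis.
From mathcomp Require Import complex.
Set Implicit Arguments.
Unset Strict Implicit.
Unset Printing Implicit Defensive.
Import Order.TTheory GRing.Theory Num.Theory.
Import numFieldNormedType.Exports.
Local Open Scope classical_set_scope.
Local Open Scope ring_scope.
Local Open Scope complex_scope.

(* C*-algebras are not assumed to be unital, so the product cannot come from
   one of the (always unital) ring structures of the library. *)
HB.mixin Record isCStarAlgebra (R : realType) A
    of CompleteNormedModule R[i] A := {
  cmul : A -> A -> A ;
  cstar : A -> A ;
  cmulA : forall a b c : A, cmul a (cmul b c) = cmul (cmul a b) c ;
  cmul_linearl : forall (k : R[i]) (a b c : A),
    cmul (k *: a + b) c = k *: cmul a c + cmul b c ;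
  cmul_linearr : forall (k : R[i]) (a b c : A),
    cmul a (k *: b + c) = k *: cmul a b + cmul a c ;
  cmul_norm : forall a b : A, `|cmul a b| <= `|a| * `|b| ;
  cstarK : forall a : A, cstar (cstar a) = a ;
  cstar_antilinear : forall (k : R[i]) (a b : A),
    cstar (k *: a + b) = (Num.conj k) *: cstar a + cstar b ;
  cstarM : forall a b : A, cstar (cmul a b) = cmul (cstar b) (cstar a) ;
  cstar_identity : forall a : A, `|cmul (cstar a) a| = `|a| ^+ 2
}.

#[short(type="cstarAlgType")]
HB.structure Definition CStarAlgebra (R : realType) :=
  {A of isCStarAlgebra R A & CompleteNormedModule R[i] A}.

Definition cpositive (R : realType) (A : cstarAlgType R) (a : A) : Prop :=
  exists b : A, a = cmul (cstar b) b.

(* The norm of X is forced by hnormE to be ||x|| = ||<x, x>||^(1/2), so that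
   the completeness of X is completeness for that norm. *)
HB.mixin Record isHilbertModule (R : realType) (A : cstarAlgType R) X
    of CompleteNormedModule R[i] X := {
  ract : X -> A -> X ;
  hinner : X -> X -> A ;
  ract_linearl : forall (k : R[i]) (x y : X) (a : A),
    ract (k *: x + y) a = k *: ract x a + ract y a ;
  ract_linearr : forall (k : R[i]) (x : X) (a b : A),
    ract x (k *: a + b) = k *: ract x a + ract x b ;
  ractM : forall (x : X) (a b : A), ract x (cmul a b) = ract (ract x a) b ;
  hinner_linearr : forall (k : R[i]) (x y z : X),
    hinner x (k *: y + z) = k *: hinner x y + hinner x z ;
  hinner_ractr : forall (x y : X) (a : A),
    hinner x (ract y a) = cmul (hinner x y) a ;
  hinner_sym : forall x y : X, hinner x y = cstar (hinner y x) ;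
  hinner_positive : forall x : X, cpositive (hinner x x) ;
  hinner_definite : forall x : X, hinner x x = 0 -> x = 0 ;
  hnormE : forall x : X, `|x| ^+ 2 = `|hinner x x|
}.

#[short(type="hilbertModType")]
HB.structure Definition HilbertModule (R : realType) (A : cstarAlgType R) :=
  {X of isHilbertModule R A X & CompleteNormedModule R[i] X}.

Section Operators.
Context {R : realType} {A : cstarAlgType R} {X : hilbertModType A}.

(* An element of L(X), given with its adjoint (which is unique). Linearity and
   boundedness are consequences of ladjP. *)
Record adjointable := Adjointable {
  lop :> X -> X ;
  ladj : X -> X ;
  ladjP : forall x y : X, hinner (lop x) y = hinner x (ladj y)
}.

Lemma ladj_adjP (T : adjointable) (x y : X) :
  hinner (ladj T x) y = hinner x (T y).
Proof. by rewrite hinner_sym -ladjP -hinner_sym. Qed.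

Definition lstar (T : adjointable) : adjointable :=
  Adjointable (ladj_adjP T).

Definition unitary_op (U : adjointable) : Prop :=
  (forall x, lstar U (U x) = x) /\ (forall x, U (lstar U x) = x).

Definition partial_isometry (V : adjointable) : Prop :=
  forall x, V (lstar V (V x)) = V x.

(* The values of ufun outside of udom are irrelevant. *)
Record unbounded_op := UnboundedOp { udom : set X ; ufun :> X -> X }.

Definition ueq (s t : unbounded_op) : Prop :=
  udom s = udom t /\ (forall x, udom s x -> s x = t x).

Definition ugraph (t : unbounded_op) : set (X * X) :=
  [set p | udom t p.1 /\ p.2 = t p.1].

Definition uker (t : unbounded_op) : set X := [set x | udom t x /\ t x = 0].

Definition uran (t : unbounded_op) : set X := t @` udom t.

Definition uop_of (T : adjointable) : unbounded_op := UnboundedOp setT T.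

Definition uid : unbounded_op := UnboundedOp setT id.

Definition uadd (s t : unbounded_op) : unbounded_op :=
  UnboundedOp (udom s `&` udom t) (fun x => s x + t x).

Definition ucomp (s t : unbounded_op) : unbounded_op :=
  UnboundedOp [set x | udom t x /\ udom s (t x)] (fun x => s (t x)).

(* The domain is a submodule and t is linear on it, over both A and the complex
   numbers: since A may lack a unit, the latter has to be required. *)
Definition ulinear (t : unbounded_op) : Prop :=
  [/\ udom t 0,
      (forall (k : R[i]) (x y : X), udom t x -> udom t y ->
         udom t (k *: x + y) /\ t (k *: x + y) = k *: t x + t y) &
      (forall (x : X) (a : A), udom t x ->
         udom t (ract x a) /\ t (ract x a) = ract (t x) a)].

Definition adjoint_rel (t : unbounded_op) (y z : X) : Prop :=
  forall x, udom t x -> hinner (t x) y = hinner x z.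

(* For a densely defined t the z chosen by xget is the only one. *)
Definition uadj (t : unbounded_op) : unbounded_op :=
  UnboundedOp [set y | exists z, adjoint_rel t y z]
       (fun y => xget 0 [set z | adjoint_rel t y z]).

Definition regular_op (t : unbounded_op) : Prop :=
  [/\ ulinear t, dense (udom t), closed (ugraph t), dense (udom (uadj t)) &
      dense (uran (uadd uid (ucomp (uadj t) t)))].

Definition selfadjoint_op (t : unbounded_op) : Prop := ueq t (uadj t).

Definition upositive (t : unbounded_op) : Prop :=
  forall x, udom t x -> cpositive (hinner x (t x)).

Definition is_positive_sqrt (T s : unbounded_op) : Prop :=
  [/\ regular_op s, selfadjoint_op s, upositive s & ueq (ucomp s s) T].

(* s = |t| *)
Definition is_modulus (t s : unbounded_op) : Prop :=
  is_positive_sqrt (ucomp (uadj t) t) s.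

Definition normal_op (t : unbounded_op) : Prop :=
  [/\ regular_op t, udom t = udom (uadj t) &
      forall x, udom t x -> hinner (t x) (t x) = hinner (uadj t x) (uadj t x)].

Definition polar_decomposition (t : unbounded_op) (V : adjointable) : Prop :=
  partial_isometry V /\
  (exists s, is_modulus t s /\ ueq t (ucomp (uop_of V) s)) /\
  [/\ uker (uop_of V) = uker t,
      uker (uop_of (lstar V)) = uker (uadj t),
      uran (uop_of V) = closure (uran t) &
      uran (uop_of (lstar V)) = closure (uran (uadj t))].

End Operators.

Arguments adjointable {R A} X.
Arguments unbounded_op {R A} X.

(* Main.v *)
Require Import Defs.
From mathcomp Require Import all_boot all_order all_algebra.
From mathcomp Require Import all_classical all_reals all_analysis.
From mathcomp Require Import complex.
Set Implicit Arguments.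
Unset Strict Implicit.
Unset Printing Implicit Defensive.
Import Order.TTheory GRing.Theory Num.Theory.
Import numFieldNormedType.Exports.
Local Open Scope classical_set_scope.
Local Open Scope ring_scope.

(* If t is normal, t^* x |-> t x is inner-product preserving by polarization and
   extends by completeness to a unitary from closure (Ran t^* ) = Ran V^* onto
   closure (Ran t) = Ran V.  Normality gives Ker t = Ker t^*, so Ker V = Ker V^*
   and the two ranges coincide; extending by the identity on Ker V produces U.
   Conversely t = U t^* is normal because U preserves the inner product.  The
   commutation relations amount to t^* U = t: the inclusion of t is immediate,
   and the equality of domains uses Dom (t^** ) = Dom t, which follows from
   t = V |t| and the selfadjointness of |t|. *)

(** * Sesquilinearity, polarization and continuity of the inner product *)

Section InnerProduct.
Context {R : realType} {A : cstarAlgType R} {X : hilbertModType A}.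
Implicit Types (x y z : X) (a : A) (k : R[i]).

Lemma cstarD (a b : A) : cstar (a + b) = cstar a + cstar b.
Proof. by have := cstar_antilinear 1 a b; rewrite rmorph1 !scale1r. Qed.

Lemma cstar0 : cstar (0 : A) = 0.
Proof. by apply: (addrI (cstar (0 : A))); rewrite -cstarD !addr0. Qed.

Lemma cstarZ k a : cstar (k *: a) = Num.conj k *: cstar a.
Proof. by have := cstar_antilinear k a 0; rewrite cstar0 !addr0. Qed.

Lemma hinnerDr x y z : hinner x (y + z) = hinner x y + hinner x z.
Proof. by have := hinner_linearr 1 x y z; rewrite !scale1r. Qed.

Lemma hinner0r x : hinner x 0 = 0.
Proof. by apply: (addrI (hinner x 0)); rewrite -hinnerDr !addr0. Qed.

Lemma hinnerZr k x y : hinner x (k *: y) = k *: hinner x y.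
Proof. by have := hinner_linearr k x y 0; rewrite hinner0r !addr0. Qed.

Lemma hinnerNr x y : hinner x (- y) = - hinner x y.
Proof. by rewrite -scaleN1r hinnerZr scaleN1r. Qed.

Lemma hinnerBr x y z : hinner x (y - z) = hinner x y - hinner x z.
Proof. by rewrite hinnerDr hinnerNr. Qed.

Lemma hinnerDl x y z : hinner (y + z) x = hinner y x + hinner z x.
Proof. by rewrite hinner_sym hinnerDr cstarD -!hinner_sym. Qed.

Lemma hinnerZl k x y : hinner (k *: x) y = Num.conj k *: hinner x y.
Proof. by rewrite hinner_sym hinnerZr cstarZ -hinner_sym. Qed.

Lemma hinner0l x : hinner 0 x = 0.
Proof. by rewrite hinner_sym hinner0r cstar0. Qed.

Lemma hinnerNl x y : hinner (- x) y = - hinner x y.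
Proof. by rewrite -scaleN1r hinnerZl rmorphN1 scaleN1r. Qed.

Lemma hinnerBl x y z : hinner (y - z) x = hinner y x - hinner z x.
Proof. by rewrite hinnerDl hinnerNl. Qed.

Lemma hinner_polarization x y :
  4%:R *: hinner x y =
    (hinner (x + y) (x + y) - hinner (x - y) (x - y)) -
    'i *: (hinner (x + 'i *: y) (x + 'i *: y) -
           hinner (x - 'i *: y) (x - 'i *: y)).
Proof.
(* The diagonal terms cancel. Replacing [y] by ['i *: y] flips the sign of <y, x> relative to <x,
   y>, by antilinearity in the first slot, so that only <x, y> survives. *)
have E z : hinner (x + z) (x + z) - hinner (x - z) (x - z) =
    (hinner x z + hinner z x) *+ 2.
  rewrite !hinnerDl !hinnerDr !hinnerNl !hinnerNr opprK.
  set a := hinner x x; set b := hinner x z; set c := hinner z x.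
  set d := hinner z z.
  rewrite !opprD !opprK addrACA [a + b + _]addrACA subrr add0r.
  by rewrite [c + d + _]addrACA subrr addr0 mulr2n addrACA.
rewrite !E hinnerZr hinnerZl conjCi scaleNr -scalerMnr scalerDr scalerN.
rewrite !scalerA -expr2 sqrCi !scaleN1r opprK mulrnDl mulrnDl opprD.
rewrite mulNrn opprK addrACA subrr addr0 -mulrnDr scaler_nat.
by [].
Qed.

(** A crude Cauchy-Schwarz bound, enough for continuity. For unit vectors, polarization writes 4 <u,
    v> with four squares of norm at most 4 each; the general case follows by rescaling. *)
Lemma norm_hinner_le x y : `|hinner x y| <= 4%:R * (`|x| * `|y|).
Proof.
have sq z : `|hinner z z| <= `|z| ^+ 2 by rewrite hnormE.
have [->|x0] := eqVneq x 0; first by rewrite hinner0l !normr0 mul0r mulr0.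
have [->|y0] := eqVneq y 0; first by rewrite hinner0r !normr0 !mulr0.
have nx : `|x| != 0 by rewrite normr_eq0.
have ny : `|y| != 0 by rewrite normr_eq0.
pose u := `|x|^-1 *: x; pose v := `|y|^-1 *: y.
have nu : `|u| = 1 by rewrite normrZ normfV normr_id mulVf.
have nv : `|v| = 1 by rewrite normrZ normfV normr_id mulVf.
have le2 z w : `|z| = 1 -> `|w| = 1 -> `|hinner (z + w) (z + w)| <= 4%:R.
  move=> hz hw; apply: le_trans (sq _) _.
  have -> : 4%:R = 2%:R ^+ 2 :> R[i] by rewrite -natrX.
  by rewrite ler_sqr ?nnegrE // (le_trans (ler_normD _ _)) ?hz ?hw.
have le4 : `|hinner u v| <= 4%:R.
  rewrite -(@ler_pM2l _ 4%:R) ?ltr0n // -[X in X * _](ger0_norm (ler0n _ 4)).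
  rewrite -normrZ hinner_polarization.
  have n1 : `|- v| = 1 by rewrite normrN.
  have n2 : `|'i *: v| = 1 by rewrite normrZ normCi mul1r.
  have n3 : `|- ('i *: v)| = 1 by rewrite normrN.
  apply: le_trans (ler_normB _ _) _; rewrite normrZ normCi mul1r.
  apply: le_trans (lerD (ler_normB _ _) (ler_normB _ _)) _.
  apply: le_trans (lerD (lerD (le2 _ _ nu nv) (le2 _ _ nu n1))
                        (lerD (le2 _ _ nu n2) (le2 _ _ nu n3))) _.
  by rewrite -!natrD -natrM.
have -> : hinner x y = (`|x| * `|y|) *: hinner u v.
  have conjx : Num.conj `|x|^-1 = `|x|^-1.
    by rewrite conj_Creal // realV normr_real.
  rewrite /u /v hinnerZr hinnerZl conjx !scalerA.
  by rewrite mulfK // divff // scale1r.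
by rewrite normrZ ger0_norm ?mulr_ge0 // mulrC ler_wpM2r // mulr_ge0.
Qed.

Lemma continuous_of_dist_le (k : R[i]) (U W : normedModType R[i])
    (f : U -> W) :
  0 <= k -> (forall u v, `|f u - f v| <= k * `|u - v|) -> continuous f.
Proof.
move=> k_ge0 fk x; apply/cvgrPdist_lt => e e0.
(* The shift by 1 keeps the divisor positive when [k = 0]. *)
have k0 : 0 < k + 1 by rewrite ltr_wpDl.
have := @cvgr_dist_lt _ _ _ (nbhs x) _ id x; rewrite /=.
move=> /(_ _ cvg_id _ (divr_gt0 e0 k0)); apply: filterS => y xy.
apply: le_lt_trans (fk _ _) _.
apply: (@le_lt_trans _ _ ((k + 1) * `|x - y|)).
  by rewrite ler_wpM2r // lerDl.
by rewrite mulrC -ltr_pdivlMr.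
Qed.

Lemma continuous_hinnerl y : continuous (fun x => hinner x y).
Proof.
apply: (@continuous_of_dist_le (4%:R * `|y|)) => [|x z].
  by rewrite mulr_ge0.
by rewrite -hinnerBl -mulrA [_ * `|_ - _|]mulrC norm_hinner_le.
Qed.

End InnerProduct.

(** * Isometric relations and their extension to unitaries *)

Section IsometricRelations.
Context {R : realType} {A : cstarAlgType R} {X : hilbertModType A}.
Implicit Types (x y z : X) (G : set (X * X)).

Lemma closure_zero (T : topologicalType) (f : T -> A) (D : set T) :
  continuous f -> (forall u, D u -> f u = 0) ->
  forall u, closure D u -> f u = 0.
Proof.
move=> cf f0 u Du.
have : closure (f @^-1` [set 0]) u by apply: closureS Du.
apply: preimage_closed => [v _|]; first exact: cf.
exact/accessible_closed_set1/hausdorff_accessible/norm_hausdorff.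
Qed.

Lemma dense_closureT (T : topologicalType) (D : set T) u :
  dense D -> closure D u.
Proof.
move=> dD B /nbhs_interior Bu; have [|v [Bv Dv]] := dD B° _ (open_interior B).
  by exists u; exact: nbhs_singleton.
by exists v; split=> //; exact: interior_subset.
Qed.

Lemma dense_orthogonal_eq0 (D : set X) z :
  dense D -> (forall x, D x -> hinner x z = 0) -> z = 0.
Proof.
move=> dD Dz; apply: hinner_definite.
have := closure_zero (@continuous_hinnerl _ _ _ z) Dz.
by apply; exact: dense_closureT.
Qed.

Lemma hinner_inj x y : (forall z, hinner z x = hinner z y) -> x = y.
Proof.
move=> xy; apply/subr0_eq/hinner_definite.
by rewrite hinnerBr xy subrr.
Qed.

(** Isometries are handled through their graphs: closing the graph extends by continuity, and
    swapping coordinates inverts. *)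
Definition isometric_rel G :=
  forall p q, G p -> G q -> hinner p.2 q.2 = hinner p.1 q.1.

(** The identity passes to the closure one argument at a time, since the inner product is continuous
    in its first argument; symmetry handles the second. *)
Lemma isometric_rel_closure G : isometric_rel G -> isometric_rel (closure G).
Proof.
have cl w z : continuous (fun p : X * X => hinner p.2 w - hinner p.1 z).
  move=> p; apply: cvgB.
    apply: (@continuous_comp _ _ _ snd (fun x => hinner x w) p).
      exact: cvg_snd.
    exact: continuous_hinnerl.
  apply: (@continuous_comp _ _ _ fst (fun x => hinner x z) p).
    exact: cvg_fst.
  exact: continuous_hinnerl.
move=> isoG p q clp clq.
have half r : G r -> hinner p.2 r.2 = hinner p.1 r.1.
  move=> Gr; apply: subr0_eq; apply: (closure_zero (cl r.2 r.1) _ clp) => s Gs.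
  by rewrite (isoG s r) // subrr.
rewrite hinner_sym [RHS]hinner_sym; congr cstar.
apply: subr0_eq; apply: (closure_zero (cl p.2 p.1) _ clq) => s Gs.
by rewrite hinner_sym (half s) // -hinner_sym subrr.
Qed.

(** All four terms in the expansion of <y - y', y - y'> equal <x, x>. *)
Lemma isometric_rel_functional G x y y' :
  isometric_rel G -> G (x, y) -> G (x, y') -> y = y'.
Proof.
move=> isoG Gy Gy'; apply/subr0_eq/hinner_definite.
have e := (isoG _ _ Gy Gy, isoG _ _ Gy Gy', isoG _ _ Gy' Gy, isoG _ _ Gy' Gy').
by rewrite hinnerBr !hinnerBl !e /= !subrr.
Qed.

Lemma isometric_rel_norm G p q :
  isometric_rel G -> G p -> G q -> `|p.2 - q.2| = `|p.1 - q.1|.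
Proof.
move=> isoG Gp Gq; apply/eqP; rewrite -(@eqrXn2 _ 2) // !hnormE.
have e := (isoG _ _ Gp Gp, isoG _ _ Gp Gq, isoG _ _ Gq Gp, isoG _ _ Gq Gq).
by rewrite !hinnerBr !hinnerBl !e.
Qed.

(** Points of [G] whose first coordinate tends to [x] have Cauchy second coordinates, by isometry;
    their limit is the required [y]. *)
Lemma isometric_rel_complete G x :
  isometric_rel G -> closure (fst @` G) x -> exists y, closure G (x, y).
Proof.
move=> isoG clx.
pose B (e : R[i]) := G `&` [set p | `|x - p.1| < e].
pose F := filter_from [set e : R[i] | 0 < e] B.
have FF : ProperFilter F.
  apply: filter_from_proper => [|e e0].
    apply: filter_from_filter => [|i j i0 j0]; first by exists 1; exact: ltr01.
    (* The order of [R[i]] is partial, so the minimum of two radii requires their comparability. *)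
    have ij : i >=< j by apply: real_comparable; exact: gtr0_real.
    exists (Order.min i j); first by rewrite /= comparable_lt_min // i0.
    move=> p [Gp]; rewrite /= comparable_lt_min // => /andP[? ?].
    by split; split.
  have [y [[p Gp <-] xp]] := clx _ (nbhsx_ballx x _ e0).
  by exists p; split => //=; move: xp; rewrite -ball_normE.
have : cvg (snd @ F).
  apply/cauchy_cvgP/cauchy_exP => e e0.
  have e20 : 0 < e / 2%:R by rewrite divr_gt0.
  have FB2 : F (B (e / 2%:R)) by exists (e / 2%:R).
  have [p [Gp xp]] := filter_ex FB2.
  exists p.2; exists (e / 2%:R) => //= q [Gq xq].
  rewrite -ball_normE /= (isometric_rel_norm isoG) //.
  rewrite [e](splitr e) (_ : p.1 - q.1 = (x - q.1) - (x - p.1)); last first.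
    by rewrite opprB [RHS]addrC addrA subrK.
  by rewrite (le_lt_trans (ler_normB _ _)) // ltrD.
move=> cvF; exists (lim (snd @ F)) => N [[N1 N2] /= [N1x N2y]] N12.
have [e /= e0 xe] := (proj1 (nbhs_ballP _ _) N1x).
have FB : F (B e) by exists e.
have [p [[Gp xp] N2p]] := filter_ex (filterI FB (cvF _ N2y)).
exists p; split => //; apply: N12; split => //=.
by apply: xe; rewrite -ball_normE.
Qed.

Lemma closure_swap G x y :
  closure [set p | G (p.2, p.1)] (x, y) -> closure G (y, x).
Proof.
move=> cl N [[N1 N2] /= [N1y N2x] N12].
have N21 : nbhs (x, y) (N2 `*` N1) by exists (N2, N1).
have [[u v] [Guv [? ?]]] := cl _ N21.
by exists (v, u); split => //; exact: N12.
Qed.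

Lemma closure_snd G x y : closure G (x, y) -> closure (snd @` G) y.
Proof.
move=> cl N Ny.
have [|p [Gp Np]] := cl (snd @^-1` N); first exact: (@cvg_snd _ _ _ _ _ _ Ny).
by exists p.2; split => //; exists p.
Qed.

Lemma adjointableD (T : adjointable X) x y : T (x + y) = T x + T y.
Proof.
apply: hinner_inj => z.
by rewrite hinnerDr -!(ladj_adjP T) hinnerDr.
Qed.

Lemma adjointableB (T : adjointable X) x y : T (x - y) = T x - T y.
Proof.
apply: hinner_inj => z.
by rewrite hinnerBr -!(ladj_adjP T) hinnerBr.
Qed.

(** [P] projects onto the common closure of the domain and the range of [G]. There [closure G] is a
    bijective isometry, inverted by the closure of the swapped relation [H]. *)
Lemma isometric_rel_unitary G (P : adjointable X) :
  isometric_rel G ->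
  (forall x y, hinner (P x) y = hinner x (P y)) ->
  (forall x, P (P x) = P x) ->
  closure (fst @` G) = range P -> closure (snd @` G) = range P ->
  exists2 U : adjointable X, unitary_op U & forall p, G p -> U p.1 = p.2.
Proof.
move=> isoG Psym PP clfst clsnd.
pose H := [set p | G (p.2, p.1)].
have isoH : isometric_rel H by move=> p q Gp Gq; rewrite -(isoG _ _ Gp Gq).
have HK : [set p | H (p.2, p.1)] = G by apply/seteqP; split=> -[].
have fstH : fst @` H = snd @` G.
  by apply/seteqP; split=> _ [[x y] Gp <-]; exists (y, x).
have sndH : snd @` H = fst @` G.
  by apply/seteqP; split=> _ [[x y] Gp <-]; exists (y, x).
have isoclG := isometric_rel_closure isoG.
have isoclH := isometric_rel_closure isoH.
have swapGH x y : closure G (x, y) -> closure H (y, x).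
  by rewrite -{1}HK; exact: closure_swap.
have sndP x y : closure G (x, y) -> P y = y.
  by move=> /closure_snd; rewrite clsnd => -[z _ <-].
have fstP x y : closure G (x, y) -> P x = x.
  by move=> /swapGH /closure_snd; rewrite sndH clfst => -[z _ <-].
(* U is closure G on the range of P and the identity on its kernel. *)
have /choice [f clf] x : exists y, closure G (P x, y).
  by apply: isometric_rel_complete => //; rewrite clfst; exists x.
have /choice [g clg] y : exists x, closure G (x, P y).
  have [|x clx] := @isometric_rel_complete H (P y) isoH.
    by rewrite fstH clsnd; exists y.
  by exists x; exact: closure_swap.
(* The adjoint is the candidate inverse: <f x, y> = <f x, P y> = <P x, g y> = <x, g y>, the middle
   equality being isometry for the pairs [(P x, f x)] and [(g y, P y)]. *)
have Uadj x y : hinner (f x + (x - P x)) y = hinner x (g y + (y - P y)).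
  rewrite hinnerDl hinnerDr hinnerBl hinnerBr Psym; congr (_ + _).
  rewrite -(sndP _ _ (clf x)) Psym (isoclG _ _ (clf x) (clg y)) /=.
  by rewrite Psym (fstP _ _ (clg y)).
exists (Adjointable Uadj); last first.
  move=> [x y] Gxy /=; have clxy := subset_closure Gxy.
  have := clf x; rewrite (fstP _ _ clxy) subrr addr0 => clx.
  exact: isometric_rel_functional clx clxy.
split=> x /=.
- have Py : P (f x + (x - P x)) = f x.
    by rewrite adjointableD adjointableB PP subrr addr0 (sndP _ _ (clf x)).
  have := clg (f x + (x - P x)); rewrite Py.
  move=> /swapGH /(isometric_rel_functional isoclH) H_eq.
  rewrite (H_eq _ (swapGH _ _ (clf x))).
  by rewrite [f x + _]addrC addrK addrC subrK.
- have Py : P (g x + (x - P x)) = g x.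
    by rewrite adjointableD adjointableB PP subrr addr0 (fstP _ _ (clg x)).
  have := clf (g x + (x - P x)); rewrite Py.
  move=> /(isometric_rel_functional isoclG) /(_ (clg x)) ->.
  by rewrite [g x + _]addrC addrK addrC subrK.
Qed.
End IsometricRelations.

(** * Adjoints of unbounded operators, and normality as an isometric relation *)

Section Adjoints.
Context {R : realType} {A : cstarAlgType R} {X : hilbertModType A}.
Implicit Types (x y z : X) (t s : unbounded_op X) (V U : adjointable X).

Lemma uadjP t y : udom (uadj t) y -> adjoint_rel t y (uadj t y).
Proof. by move=> ty; exact: (@xgetPex _ 0 _ ty). Qed.

Lemma uadjE t y z : dense (udom t) -> adjoint_rel t y z -> uadj t y = z.
Proof.
move=> dt tyz; apply/subr0_eq/(dense_orthogonal_eq0 dt) => x xt.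
have ty : udom (uadj t) y by exists z.
by rewrite hinnerBr -(uadjP ty) // -tyz // subrr.
Qed.

Lemma uadj_linear t k x y : dense (udom t) ->
  udom (uadj t) x -> udom (uadj t) y ->
  udom (uadj t) (k *: x + y) /\ uadj t (k *: x + y) = k *: uadj t x + uadj t y.
Proof.
move=> dt tx ty.
have h : adjoint_rel t (k *: x + y) (k *: uadj t x + uadj t y).
  by move=> w tw; rewrite !hinner_linearr (uadjP tx) // (uadjP ty).
by split; [exists (k *: uadj t x + uadj t y) | exact: uadjE].
Qed.

Lemma unitary_hinner U x y : unitary_op U -> hinner (U x) (U y) = hinner x y.
Proof. by case=> U'U _; rewrite ladjP; congr hinner; exact: U'U. Qed.

(** Normality only equates <t x, t x> with <t^* x, t^* x>; applied to [x + k y] for [k] among 1, -1,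
    i, -i, it gives all inner products by polarization. *)
Lemma normal_isometric_rel t :
  normal_op t ->
  isometric_rel [set p | exists2 x, udom t x & p = (uadj t x, t x)].
Proof.
case=> -[[_ tlin _] dt _ _ _] dom tt' _ _ [x tx ->] [y ty ->] /=.
apply: (@scalerI _ _ (4%:R : R[i])); first by rewrite pnatr_eq0.
rewrite !hinner_polarization.
have E k : hinner (t x + k *: t y) (t x + k *: t y) =
   hinner (uadj t x + k *: uadj t y) (uadj t x + k *: uadj t y).
  rewrite ![_ + k *: _]addrC.
  have [h1 <-] := tlin k y x ty tx.
  have [] := @uadj_linear t k y x dt; rewrite -?dom // => _ <-.
  exact: tt'.
have := E 1; have := E (- 1); rewrite !scaleN1r !scale1r => -> ->.
by have := E 'i; have := E (- 'i); rewrite !scaleNr => -> ->.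
Qed.

(** * Normality and unitaries under a polar decomposition *)

Section PolarDecomposition.
Context {t : unbounded_op X} {V : adjointable X}.
Hypotheses (t_regular : regular_op t) (t_polar : polar_decomposition t V).

Let dense_t : dense (udom t). Proof. by case: t_regular. Qed.

Lemma normal_uker_uadj : normal_op t -> uker (uadj t) = uker t.
Proof.
case=> _ dom tt'; apply/seteqP; split=> x [tx].
  move=> t0; split; first by rewrite dom.
  by apply: hinner_definite; rewrite tt' ?t0 ?hinner0r // dom.
move=> t0; split; first by rewrite -dom.
by apply: hinner_definite; rewrite -tt' ?t0 ?hinner0r.
Qed.

Lemma normal_unitary : normal_op t ->
  exists U : adjointable X, unitary_op U /\ ueq t (ucomp (uop_of U) (uadj t)).
Proof.
move=> tnormal; have [_ dom _] := tnormal.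
have [Viso [_ [kerV kerV' ranV ranV']]] := t_polar.
have V'VV' x : lstar V (V (lstar V x)) = lstar V x.
  apply: hinner_inj => z.
  by rewrite -(ladjP V) -(ladj_adjP V) -(ladjP V) Viso ladjP.
have ker x : V x = 0 <-> lstar V x = 0.
  have := normal_uker_uadj tnormal; rewrite -kerV -kerV' => e.
  have : uker (uop_of (lstar V)) x <-> uker (uop_of V) x by rewrite e.
  by rewrite /uker /=; tauto.
pose P := Adjointable (lop := fun x => lstar V (V x))
  (fun x y => etrans (ladj_adjP V (V x) y) (ladjP V x (V y))).
(* [P x - x] lies in Ker V, hence in Ker V^*. Dually [V (lstar V x) - x] lies in both kernels, which
   gives [VQ]; [V'VV] is the adjoint of [V'P]. *)
have V'P x : lstar V (P x) = lstar V x.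
  apply: subr0_eq; rewrite -adjointableB; apply/ker.
  by rewrite adjointableB /= Viso subrr.
have VQ x : V (V (lstar V x)) = V x.
  apply: subr0_eq; rewrite -adjointableB; apply/ker.
  by rewrite adjointableB V'VV' subrr.
have V'VV x : lstar V (V (V x)) = V x.
  apply: hinner_inj => z.
  by rewrite -ladjP -(ladj_adjP V) -(ladj_adjP V) [ladj _ _](V'P z) ladj_adjP.
(* Ker V = Ker V^* forces the two range projections V^* V and V V^* to agree. *)
have PE x : P x = V (lstar V x) by rewrite -[RHS]V'VV VQ.
have PP x : P (P x) = P x by rewrite /= Viso.
have ranP : range P = range (lstar V).
  apply/seteqP; split=> _ [x _ <-]; first by exists (V x).
  by exists (lstar V x) => //; exact: V'VV'.
have ranP' : range P = range V.
  apply/seteqP; split=> _ [x _ <-]; first by rewrite PE; exists (lstar V x).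
  by exists (V x) => //; rewrite PE Viso.
pose G := [set p | exists2 x, udom t x & p = (uadj t x, t x)].
have fstG : fst @` G = uran (uadj t).
  apply/seteqP; split=> [_ [_ [x tx ->] <-]|_ [x tx <-]] /=.
    by exists x => //; rewrite -dom.
  by exists (uadj t x, t x) => //; exists x => //; rewrite dom.
have sndG : snd @` G = uran t.
  apply/seteqP; split=> [_ [_ [x tx ->] <-]|_ [x tx <-]] /=; first by exists x.
  by exists (uadj t x, t x) => //; exists x.
have [||||U Uu UG] := isometric_rel_unitary (P := P)
  (normal_isometric_rel tnormal).
- by move=> x y; rewrite ladjP.
- by [].
- by rewrite fstG -ranV' ranP.
- by rewrite sndG -ranV ranP'.
exists U; split=> //; split=> /= [|x tx].
  by rewrite dom; apply/seteqP; split=> x // [].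
by have /= -> := UG (uadj t x, t x) (ex_intro2 _ _ x tx erefl).
Qed.

(* V^* V fixes the range of s = |t|, so t^* V extends s; hence y in Dom(t^** )
   lies in Dom(s^* ) = Dom(s) = Dom(t). *)
Lemma polar_biadjoint y :
  udom (uadj (uadj t)) y -> udom t y.
Proof.
have [Viso [[s [[_ sself _ s2] tVs]] [kerV _ _ _]]] := t_polar.
have domst x : udom s x <-> udom t x.
  by rewrite tVs.1 /=; split=> // -[].
have tE x : udom s x -> t x = V (s x) by move=> /domst /tVs.2.
have symm x w : udom s x -> udom s w -> hinner (s x) w = hinner x (s w).
  move=> sx sw; have sw' : udom (uadj s) w by rewrite -sself.1.
  by rewrite (uadjP sw') // -sself.2.
(* Ker V = Ker t lies in Dom(t^* t) = Dom(s s), so <s k, s k> = <k, s (s k)> = <k, t^* t k> = 0. *)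
have ker_s k : V k = 0 -> udom s k /\ s k = 0.
  move=> Vk.
  have [tk tk0] : uker t k by rewrite -kerV.
  have rel0 : adjoint_rel t 0 0 by move=> w _; rewrite !hinner0r.
  have : udom (ucomp (uadj t) t) k by split=> //; exists 0; rewrite tk0.
  rewrite -s2.1 => -[sk ssk]; split=> //.
  have ssE : s (s k) = uadj t (t k) := s2.2 k (conj sk ssk).
  apply: hinner_definite; rewrite symm // ssE.
  by rewrite tk0 (uadjE dense_t rel0) hinner0r.
(* The difference [k] lies in Ker V, hence in Ker s, so it is orthogonal to both of its own
   terms. *)
have V'Vs x : udom s x -> lstar V (V (s x)) = s x.
  move=> sx; apply: subr0_eq; set k := _ - _.
  have Vk : V k = 0 by rewrite adjointableB Viso subrr.
  have [sk sk0] := ker_s _ Vk.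
  apply: hinner_definite; rewrite {1}/k hinnerBl ladj_adjP Vk hinner0r.
  by rewrite symm // sk0 hinner0r subrr.
have t'V x : udom s x -> udom (uadj t) (V x) /\ uadj t (V x) = s x.
  move=> sx; have rel : adjoint_rel t (V x) (s x).
    move=> w /domst sw; rewrite tE // -(ladj_adjP V) [ladj _ _](V'Vs w sw).
    exact: symm.
  by split; [exists (s x) | exact: uadjE].
move=> /uadjP ty; apply/domst; rewrite sself.1.
(* The witness comes from <s x, y> = <t^* V x, y> = <V x, t^** y>. *)
exists (lstar V (uadj (uadj t) y)) => x sx.
have [dVx <-] := t'V x sx.
by rewrite ty // ladjP.
Qed.

Lemma unitary_normal U :
  unitary_op U -> ueq t (ucomp (uop_of U) (uadj t)) -> normal_op t.
Proof.
move=> Uu [dom tU]; split => // [|x tx].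
  by rewrite dom; apply/seteqP; split=> x // [].
by rewrite [t x](tU x tx) /ucomp unitary_hinner.
Qed.

Lemma unitary_commutes U :
  unitary_op U -> ueq t (ucomp (uop_of U) (uadj t)) ->
  [/\ udom t = udom (uadj t),
      ueq (ucomp t (uop_of U)) (ucomp (uop_of U) t) &
      ueq (ucomp (uadj t) (uop_of U)) (ucomp (uop_of U) (uadj t))].
Proof.
move=> Uu tU; have [_ dom _] := unitary_normal Uu tU.
have {}tU x : udom t x -> t x = U (uadj t x) := tU.2 x.
(* <t w, U x> = <U t^* w, U x> = <t^* w, x> = <w, t x>, so t^* U extends t. *)
have t'U x : udom t x -> udom (uadj t) (U x) /\ uadj t (U x) = t x.
  move=> tx; have rel : adjoint_rel t (U x) (t x).
    move=> w tw; have tw' : udom (uadj t) w by rewrite -dom.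
    rewrite tU // unitary_hinner //.
    by rewrite hinner_sym -(uadjP tw') // -hinner_sym.
  by split; [exists (t x) | exact: uadjE].
(* <t^* w, x> = <U t^* w, U x> = <t w, U x> = <w, t^* U x> puts [x] in the domain of t^**. *)
have domU x : udom t (U x) -> udom t x.
  rewrite {1}dom => tUx; apply: polar_biadjoint.
  exists (uadj t (U x)) => w; rewrite -dom => tw.
  by rewrite -(uadjP tUx) // tU // unitary_hinner.
have domE : udom (ucomp t (uop_of U)) = udom t.
  apply/seteqP; split=> x /= => [[_ /domU //]|tx].
  by split=> //; rewrite dom; exact: (t'U x tx).1.
have domE' : udom (ucomp (uadj t) (uop_of U)) = udom t.
  by rewrite -domE /ucomp /= dom.
split=> //; split.
- by rewrite domE; apply/seteqP; split=> x // [].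
(* t U x = U t^* U x = U t x. *)
- rewrite domE => x tx; have [t'Ux t'UxE] := t'U x tx.
  rewrite -dom in t'Ux; exact: etrans (tU _ t'Ux) (congr1 U t'UxE).
- by rewrite domE' dom; apply/seteqP; split=> x // [].
- by rewrite domE' => x tx; exact: etrans (t'U x tx).2 (tU x tx).
Qed.

End PolarDecomposition.
End Adjoints.

Theorem theorem2p5 (R : realType) (A : cstarAlgType R) (X : hilbertModType A)
    (t : unbounded_op X) (V : adjointable X)
    (t_regular : regular_op t) (t_polar : polar_decomposition t V) :
  (normal_op t <->
   exists U : adjointable X,
     unitary_op U /\ ueq t (ucomp (uop_of U) (uadj t))) /\
  (forall U : adjointable X,
     unitary_op U -> ueq t (ucomp (uop_of U) (uadj t)) ->
     [/\ udom t = udom (uadj t),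
         ueq (ucomp t (uop_of U)) (ucomp (uop_of U) t) &
         ueq (ucomp (uadj t) (uop_of U))
             (ucomp (uop_of U) (uadj t))]).
Proof.
split=> [|U Uu tU]; last exact: (unitary_commutes t_regular t_polar Uu tU).
split=> [tn|]; first exact: (normal_unitary t_polar tn).
by case=> U [Uu tU]; exact: (unitary_normal t_regular Uu tU).
Qed.
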